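(* Let $\mathcal L$ be a decomposable Lie algebra over a field $\mathbb F$. (i) If $\mathcal L=\mathcal L_1\oplus\mathbb F^k$ for some noncommutative Lie subalgebra $\mathcal L_1\subseteq\mathcal L$ (and some positive integer $k$), then $\Gamma(\mathcal L)$ is connected if and only if $\Gamma(\mathcal L_1)$ is connected. Moreover, $\mathrm{diam}(\Gamma(\mathcal L))=\mathrm{diam}(\Gamma(\mathcal L_1))$ (when these graphs are connected). (ii) If $\mathcal L=\mathcal L_1\oplus\mathcal L_2$ for some noncommutative Lie subalgebras $\mathcal L_1$ and $\mathcal L_2$ of $\mathcal L$, then $\Gamma(\mathcal L)$ is connected. Moreover, $\mathrm{diam}(\Gamma(\mathcal L))\le 3$.
   Context: For a noncommutative (i.e. nonabelian) Lie algebra $\mathcal L$ with center $Z(\mathcal L)$, the commuting graph $\Gamma(\mathcal L)$ is the simple undirected graph with vertex set $V_{\mathcal L}=\mathcal L\setminus Z(\mathcal L)$, in which two distinct vertices $x,y$ are adjacent if and only if $[x,y]=0$. The distance between two vertices is the length (number of edges) of a shortest path joining them, a graph is connected if every pair of distinct vertices is joined by a path, and the diameter of a connected graph is the supremum (possibly $\infty$) of the distances between distinct vertices; the diameter is only defined for connected graphs. The direct sum $\mathcal L_1\oplus\mathcal L_2$ of Lie algebras is the vector space direct sum with bracket $[x_1+x_2,y_1+y_2]=[x_1,y_1]+[x_2,y_2]$. $\mathbb F^k$ denotes the $k$-dimensional commutative (abelian) Lie algebra. A Lie algebra is decomposable if it is the direct sum (as Lie algebras) of two non-trivial Lie subalgebras.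 *)

(* Defs.v *)
From HB Require Import structures.
From mathcomp Require Import all_boot all_order all_algebra.
From mathcomp Require Import boolp classical_sets reals constructive_ereal ereal.

Set Implicit Arguments.
Unset Strict Implicit.
Unset Printing Implicit Defensive.

Import Order.TTheory GRing.Theory Num.Theory.
Local Open Scope ring_scope.
Local Open Scope classical_set_scope.

(* Lie algebras over a field, of arbitrary (possibly infinite) dimension. The
   bracket is required to be alternating rather than just skew-symmetric, as is
   needed in characteristic 2. *)
HB.mixin Record Lmodule_isLieAlgebra (F : fieldType) L & GRing.Lmodule F L := {
  lie : L -> L -> L;
  lieDl : forall x y z, lie (x + y) z = lie x z + lie y z;
  lieZl : forall (a : F) x y, lie (a *: x) y = a *: lie x y;
  lieDr : forall x y z, lie x (y + z) = lie x y + lie x z;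
  lieZr : forall (a : F) x y, lie x (a *: y) = a *: lie x y;
  liexx : forall x, lie x x = 0;
  lie_jacobi : forall x y z,
    lie x (lie y z) + lie y (lie z x) + lie z (lie x y) = 0
}.

#[short(type="lieAlgType")]
HB.structure Definition LieAlgebra (F : fieldType) :=
  { L of Lmodule_isLieAlgebra F L & GRing.Lmodule F L }.

Definition noncommutative (F : fieldType) (L : lieAlgType F) : Prop :=
  exists x y : L, lie x y != 0.

Definition lie_center (F : fieldType) (L : lieAlgType F) : set L :=
  [set x | forall y, lie x y = 0].
Arguments lie_center {F} L _.

Definition lie_isomorphic (F : fieldType) (L M : lieAlgType F) : Prop :=
  exists f : {linear L -> M},
    bijective f /\ forall x y, f (lie x y) = lie (f x) (f y).

(* [sublie_of S] below is the Lie subalgebra [S] regarded as a Lie algebra in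
   its own right, in the manner of [subvs_of] for vector subspaces. *)
Record lieSubalg (F : fieldType) (L : lieAlgType F) := LieSubalg {
  lie_carrier :> {pred L};
  lie_submod_closed : submod_closed lie_carrier;
  lie_bracket_closed : {in lie_carrier &, forall x y, lie x y \in lie_carrier}
}.

Section SubLie.
Variables (F : fieldType) (L : lieAlgType F) (S : lieSubalg L).

Record sublie_of := SubLie { sublie_val : L; _ : sublie_val \in S }.

HB.instance Definition _ := [isSub for sublie_val].
HB.instance Definition _ := [Choice of sublie_of by <:].
HB.instance Definition _ := GRing.SubChoice_isSubLmodule.Build F L _ sublie_of
  (GRing.submod_closed_semi (lie_submod_closed S)).

Definition sublie_lie (x y : sublie_of) : sublie_of :=
  SubLie (lie_bracket_closed (valP x) (valP y)).

Fact sublie_lieDl x y z :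
  sublie_lie (x + y) z = sublie_lie x z + sublie_lie y z.
Proof. apply: val_inj; exact: lieDl. Qed.

Fact sublie_lieZl (a : F) x y : sublie_lie (a *: x) y = a *: sublie_lie x y.
Proof. apply: val_inj; exact: lieZl. Qed.

Fact sublie_lieDr x y z :
  sublie_lie x (y + z) = sublie_lie x y + sublie_lie x z.
Proof. apply: val_inj; exact: lieDr. Qed.

Fact sublie_lieZr (a : F) x y : sublie_lie x (a *: y) = a *: sublie_lie x y.
Proof. apply: val_inj; exact: lieZr. Qed.

Fact sublie_liexx x : sublie_lie x x = 0.
Proof. apply: val_inj; exact: liexx. Qed.

Fact sublie_jacobi x y z :
  sublie_lie x (sublie_lie y z) + sublie_lie y (sublie_lie z x)
    + sublie_lie z (sublie_lie x y) = 0.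
Proof. apply: val_inj; exact: lie_jacobi. Qed.

HB.instance Definition _ := Lmodule_isLieAlgebra.Build F sublie_of
  sublie_lieDl sublie_lieZl sublie_lieDr sublie_lieZr sublie_liexx
  sublie_jacobi.
End SubLie.

Definition abelian_lie (F : fieldType) (k : nat) : Type := 'rV[F]_k.

Section AbelianLie.
Variables (F : fieldType) (k : nat).
Local Notation A := (abelian_lie F k).

HB.instance Definition _ := GRing.Lmodule.on A.

Definition abelian_bracket (x y : A) : A := 0.

Fact abelian_lieDl x y z :
  abelian_bracket (x + y) z = abelian_bracket x z + abelian_bracket y z.
Proof. by rewrite /abelian_bracket addr0. Qed.

Fact abelian_lieZl (a : F) x y :
  abelian_bracket (a *: x) y = a *: abelian_bracket x y.
Proof. by rewrite /abelian_bracket scaler0. Qed.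

Fact abelian_lieDr x y z :
  abelian_bracket x (y + z) = abelian_bracket x y + abelian_bracket x z.
Proof. by rewrite /abelian_bracket addr0. Qed.

Fact abelian_lieZr (a : F) x y :
  abelian_bracket x (a *: y) = a *: abelian_bracket x y.
Proof. by rewrite /abelian_bracket scaler0. Qed.

Fact abelian_liexx x : abelian_bracket x x = 0.
Proof. by []. Qed.

Fact abelian_jacobi x y z :
  abelian_bracket x (abelian_bracket y z)
    + abelian_bracket y (abelian_bracket z x)
    + abelian_bracket z (abelian_bracket x y) = 0.
Proof. by rewrite /abelian_bracket !addr0. Qed.

HB.instance Definition _ := Lmodule_isLieAlgebra.Build F A
  abelian_lieDl abelian_lieZl abelian_lieDr abelian_lieZr abelian_liexx
  abelian_jacobi.
End AbelianLie.

(* L is the internal direct sum of S and T: as a vector space, and with the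
   componentwise bracket. *)
Definition is_direct_sum (F : fieldType) (L : lieAlgType F)
    (S T : lieSubalg L) : Prop :=
  (forall x : L, exists! st : sublie_of S * sublie_of T,
     x = val st.1 + val st.2) /\
  (forall x1 x2 y1 y2, x1 \in S -> y1 \in S -> x2 \in T -> y2 \in T ->
     lie (x1 + x2) (y1 + y2) = lie x1 y1 + lie x2 y2).

Definition nontrivial_lie (F : fieldType) (L : lieAlgType F) : Prop :=
  exists x : L, x != 0.

Definition decomposable (F : fieldType) (L : lieAlgType F) : Prop :=
  exists S T : lieSubalg L, [/\ nontrivial_lie (sublie_of S),
    nontrivial_lie (sublie_of T) & is_direct_sum S T].

Record sgraph := SGraph {
  vertex :> choiceType;
  adj : rel vertex;
  adj_sym : symmetric adj;
  adj_irr : irreflexive adj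
}.

(* x :: p is a path from x to y; its length is size p. *)
Definition is_path (G : sgraph) (x y : G) (p : seq G) : bool :=
  [&& path (@adj G) x p, last x p == y & uniq (x :: p)].

Definition gconnected (G : sgraph) : Prop :=
  forall x y : G, x != y -> exists p, is_path x y p.

(* Distances and diameters are valued in the extended reals: the distance
   between two vertices not joined by a path is ereal_inf set0 = +oo. *)
Definition gdist (R : realType) (G : sgraph) (x y : G) : \bar R :=
  ereal_inf [set ((size p)%:R : R)%:E | p in [set p | is_path x y p]].

Definition diam (R : realType) (G : sgraph) : \bar R :=
  ereal_sup [set gdist R xy.1 xy.2 | xy in [set xy : G * G | xy.1 != xy.2]].

Section CommutingGraph.
Variables (F : fieldType) (L : lieAlgType F).

Definition noncentral := {x : L | x \notin lie_center L}.

Definition commuting_adj : rel noncentral :=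
  [rel x y | (x != y) && (lie (val x) (val y) == 0)].

Fact commuting_adj_sym : symmetric commuting_adj.
Proof.
move=> x y; rewrite /commuting_adj /= eq_sym; congr andb.
have -> : lie (val y) (val x) = - lie (val x) (val y).
  apply/eqP; rewrite -addr_eq0; have := liexx (val x + val y).
  by rewrite lieDl !lieDr !liexx add0r addr0 addrC => ->.
by rewrite oppr_eq0.
Qed.

Fact commuting_adj_irr : irreflexive commuting_adj.
Proof. by move=> x; rewrite /commuting_adj /= eqxx. Qed.

Definition commuting_graph : sgraph :=
  SGraph commuting_adj_sym commuting_adj_irr.
End CommutingGraph.

(* Main.v *)
Require Import Defs.
From mathcomp Require Import all_boot all_order all_algebra.
From mathcomp Require Import boolp classical_sets reals constructive_ereal ereal.

(** Write [x = x1 + x2] for the components of [x] in a direct sum.  Two elements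
    commute iff both pairs of components commute ([lie_eq0]), and [x] is central
    iff both its components are ([center_sum]).

    (i) If the second summand is abelian, centrality and commutation only depend
    on the first components.  Hence the commuting graph of the sum is obtained
    from that of the first summand by replacing every vertex [u] by the clique
    of all [x] with [x1 = u].  Paths project along such a blow-up and lift back
    with the same length as long as their ends lie over distinct vertices
    ([is_path_lift]), so connectedness is the same on both sides.  The only new
    distances are those inside a clique; they equal 1, and so they cannot exceed
    the diameter of a graph with at least two vertices ([diam_blowup]).

    (ii) An element of one summand commutes with every element of the other one,
    and [x] commutes with [x1] and with [x2].  If [x1] and [y2] are not central,
    this gives the walk [x, x1, y2, y]; likewise if [x2] and [y1] are not
    central.  Otherwise [x] and [y] both have a central component in the same
    summand, and then both commute with any noncentral element of that summand
    ([commuting_walk3]).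

    In both parts it is convenient to produce walks whose consecutive vertices
    are adjacent or equal; cutting out the loops makes them genuine paths
    ([is_path_of_walk]). *)

Set Implicit Arguments.
Unset Strict Implicit.
Unset Printing Implicit Defensive.

Import Order.TTheory GRing.Theory Num.Theory.
Local Open Scope ring_scope.
Local Open Scope classical_set_scope.

(** * Walks, distances and diameters *)

Definition weak_adj (G : sgraph) : rel G := [rel x y | (x == y) || adj x y].

Lemma adjW (G : sgraph) : subrel (@adj G) (@weak_adj G).
Proof. by move=> x y xy; rewrite /weak_adj /= xy orbT. Qed.

(** Removing the loops of the walk leaves pairwise distinct vertices, between
    which weak adjacency is adjacency. *)
Lemma is_path_of_walk (G : sgraph) (x y : G) (p : seq G) :
  path (@weak_adj G) x p -> last x p = y ->
  exists2 q, is_path x y q & (size q <= size p)%N.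
Proof.
move=> xp; case/shortenP: xp => q xq uq /uniq_leq_size sqp lastq.
exists q; last by apply: sqp; case/andP: uq.
rewrite /is_path lastq eqxx uq !andbT /=.
elim: q x xq uq {sqp lastq} => //= z q IH x /andP[xz zq] /andP[].
rewrite inE negb_or => /andP[x'z _] uq.
by move: xz; rewrite /weak_adj /= (negPf x'z) /= => ->; exact: IH.
Qed.

Lemma gdist_le (R : realType) (G H : sgraph) (x y : G) (u v : H) :
  (forall p, is_path u v p -> exists2 q, is_path x y q & (size q <= size p)%N) ->
  (gdist R x y <= gdist R u v)%E.
Proof.
move=> uv_xy; apply: le_ereal_inf_tmp => _ [p /= /uv_xy[q xy_q le_qp] <-].
apply: (@le_trans _ _ ((size q)%:R : R)%:E); last by rewrite lee_fin ler_nat.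
by apply: ereal_inf_lbound; exists q.
Qed.

Lemma diam_le (R : realType) (G H : sgraph) :
  (forall x y : G, x != y ->
     exists u v : H, u != v /\ (gdist R x y <= gdist R u v)%E) ->
  (diam R G <= diam R H)%E.
Proof.
move=> GH; apply: ge_ereal_sup => _ [[x y] /= /GH[u [v [neq_uv le_d]]] <-].
by apply: (le_trans le_d); apply: ereal_sup_ubound; exists (u, v).
Qed.

Lemma diam_le_nat (R : realType) (G : sgraph) (n : nat) :
  (forall x y : G, x != y -> exists2 p, is_path x y p & (size p <= n)%N) ->
  (diam R G <= (n%:R : R)%:E)%E.
Proof.
move=> Gn; apply: ge_ereal_sup => _ [[x y] /= /Gn[p xy_p le_pn] <-].
apply: (@le_trans _ _ ((size p)%:R : R)%:E); last by rewrite lee_fin ler_nat.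
by apply: ereal_inf_lbound; exists p.
Qed.

(** * Blow-ups of a graph *)

Section Blowup.
Variables (G H : sgraph) (f : G -> H) (s : H -> G).
Hypothesis sK : cancel s f.
(** With the section [s], this says that [G] is [H] with each vertex [u] replaced
    by a clique, the fibre of [f] over [u]. *)
Hypothesis weak_adj_f : forall x y, weak_adj x y = weak_adj (f x) (f y).

Lemma path_weak_map x p :
  path (@weak_adj G) x p = path (@weak_adj H) (f x) (map f p).
Proof. by rewrite path_map; apply: eq_path => y z; exact: weak_adj_f. Qed.

Lemma is_path_proj x y p : is_path x y p ->
  exists2 q, is_path (f x) (f y) q & (size q <= size p)%N.
Proof.
case/and3P=> xp /eqP <- _; rewrite -(size_map f p); apply: is_path_of_walk.
  by rewrite -path_weak_map; apply: sub_path xp; exact: adjW.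
by rewrite last_map.
Qed.

(** The inner vertices are lifted by [s], while the last vertex must be lifted
    to [y] itself; there is a last vertex because the ends are distinct. *)
Lemma is_path_lift x y p : f x != f y -> is_path (f x) (f y) p ->
  exists2 q, is_path x y q & (size q <= size p)%N.
Proof.
move=> neq /and3P[xp /eqP].
case/lastP: p xp => [_ /= eq_f|p v xp]; first by rewrite eq_f eqxx in neq.
rewrite last_rcons => def_v _; rewrite {v}def_v in xp *.
have -> : size (rcons p (f y)) = size (rcons (map s p) y).
  by rewrite !size_rcons size_map.
apply: is_path_of_walk; last by rewrite last_rcons.
rewrite path_weak_map map_rcons mapK //.
by apply: sub_path xp; exact: adjW.
Qed.

Lemma is_path_fibre x y : f x = f y ->
  exists2 q, is_path x y q & (size q <= 1)%N.
Proof.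
move=> eq_f; apply: (@is_path_of_walk _ x y [:: y]) => //=.
by rewrite weak_adj_f eq_f /weak_adj /= eqxx.
Qed.

Lemma gconnected_blowup : gconnected G <-> gconnected H.
Proof.
split=> [cG u v neq | cH x y _].
  have neq_s : s u != s v by rewrite (inj_eq (can_inj sK)).
  by have [p /is_path_proj[q]] := cG _ _ neq_s; rewrite !sK; exists q.
have [/is_path_fibre[q] | neq] := eqVneq (f x) (f y); first by exists q.
by have [p /(is_path_lift neq)[q]] := cH _ _ neq; exists q.
Qed.

(** Two distinct vertices of [H] are at distance at least 1, which bounds the
    distances inside the fibres. *)
Lemma diam_blowup (R : realType) :
  (exists u v : H, u != v) -> diam R G = diam R H.
Proof.
case=> u0 [v0 neq0]; apply/eqP; rewrite eq_le; apply/andP; split.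
  apply: diam_le => x y _; have [eq_f | neq] := eqVneq (f x) (f y).
    exists u0, v0; split=> //; apply: gdist_le => p uv_p.
    have [q xy_q le_q1] := is_path_fibre eq_f.
    exists q => //; apply: leq_trans le_q1 _.
    by case: p uv_p => //= /and3P[_ /= eq0]; rewrite (negPf neq0) in eq0.
  by exists (f x), (f y); split=> //; apply: gdist_le => p /(is_path_lift neq).
apply: diam_le => u v neq; exists (s u), (s v).
split; first by rewrite (inj_eq (can_inj sK)).
by apply: gdist_le => p /is_path_proj; rewrite !sK.
Qed.

End Blowup.

(** * Commutation and centres *)

Section Lie.
Variables (F : fieldType) (L : lieAlgType F).
Implicit Types x y : L.

Lemma lie0l x : lie 0 x = 0.
Proof. by have := lieZl 0 (0 : L) x; rewrite !scale0r. Qed.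

Lemma lie0r x : lie x 0 = 0.
Proof. by have := lieZr 0 x (0 : L); rewrite !scale0r. Qed.

Lemma lie_eq0C x y : lie x y = 0 -> lie y x = 0.
Proof.
move=> xy0; have := liexx (x + y).
by rewrite lieDl !lieDr !liexx xy0 !add0r addr0.
Qed.

Lemma centerP x : reflect (forall y, lie x y = 0) (x \in lie_center L).
Proof. by apply: (iffP idP) => [/set_mem | ?]; last exact/mem_set. Qed.

Lemma notin_center x y : lie x y != 0 -> x \notin lie_center L.
Proof. by apply: contraNN => /centerP ->. Qed.

Lemma noncommutative_noncentral :
  noncommutative L -> exists x : L, x \notin lie_center L.
Proof. by case=> x [y /notin_center]; exists x. Qed.

Definition to_vertex x (nx : x \notin lie_center L) : commuting_graph L :=
  exist _ x nx.

Lemma weak_adj_commuting (x y : commuting_graph L) :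
  weak_adj x y = (lie (val x) (val y) == 0).
Proof.
rewrite /weak_adj /= /commuting_adj /=.
by case: eqVneq => //= ->; rewrite liexx eqxx.
Qed.

Lemma noncommutative_two_vertices :
  noncommutative L -> exists u v : commuting_graph L, u != v.
Proof.
case=> x [y nxy]; have nyx : lie y x != 0.
  by apply: contraNneq nxy => /lie_eq0C ->.
exists (to_vertex (notin_center nxy)), (to_vertex (notin_center nyx)).
by rewrite -val_eqE /=; apply: contraNneq nxy => ->; rewrite liexx.
Qed.

End Lie.

Lemma isomorphic_abelian (F : fieldType) (L : lieAlgType F) (k : nat) :
  lie_isomorphic L (abelian_lie F k) -> forall x y : L, lie x y = 0.
Proof.
case=> f [/bij_inj f_inj fM] x y; apply: f_inj.
by rewrite fM linear0.
Qed.

(** * Commuting graphs of direct sums *)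

Section DirectSum.
Variables (F : fieldType) (L : lieAlgType F) (S T : lieSubalg L).
Hypothesis sumST : is_direct_sum S T.

Definition components (x : L) : sublie_of S * sublie_of T :=
  sval (cid (sumST.1 x)).
Definition pr1 x := (components x).1.
Definition pr2 x := (components x).2.

Lemma components_sum x : x = val (pr1 x) + val (pr2 x).
Proof. by rewrite /pr1 /pr2 /components; case: cid => st /= []. Qed.

Lemma componentsE (s : sublie_of S) (t : sublie_of T) :
  components (val s + val t) = (s, t).
Proof. by rewrite /components; case: cid => st /= [_ uniq_st]; exact: uniq_st. Qed.

Lemma pr1D (s : sublie_of S) (t : sublie_of T) : pr1 (val s + val t) = s.
Proof. by rewrite /pr1 componentsE. Qed.

Lemma pr2D (s : sublie_of S) (t : sublie_of T) : pr2 (val s + val t) = t.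
Proof. by rewrite /pr2 componentsE. Qed.

Lemma pr1_val (s : sublie_of S) : pr1 (val s) = s.
Proof. by rewrite -(addr0 (val s)); exact: (pr1D s 0). Qed.

Lemma pr2_val (s : sublie_of S) : pr2 (val s) = 0.
Proof. by rewrite -(addr0 (val s)); exact: (pr2D s 0). Qed.

Lemma pr1_valr (t : sublie_of T) : pr1 (val t) = 0.
Proof. by rewrite -(add0r (val t)); exact: (pr1D 0 t). Qed.

Lemma pr2_valr (t : sublie_of T) : pr2 (val t) = t.
Proof. by rewrite -(add0r (val t)); exact: (pr2D 0 t). Qed.

Lemma lie_sum x y :
  lie x y = val (lie (pr1 x) (pr1 y)) + val (lie (pr2 x) (pr2 y)).
Proof.
rewrite {1}(components_sum x) {1}(components_sum y).
by apply: sumST.2; exact: valP.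
Qed.

Lemma lie_eq0 x y :
  lie x y = 0 <-> lie (pr1 x) (pr1 y) = 0 /\ lie (pr2 x) (pr2 y) = 0.
Proof.
rewrite lie_sum; split=> [xy0 | [-> ->]]; last by rewrite addr0.
split.
  rewrite -[LHS](pr1D _ (lie (pr2 x) (pr2 y))) xy0.
  exact: (pr1_val 0).
rewrite -[LHS](pr2D (lie (pr1 x) (pr1 y))) xy0.
exact: (pr2_val 0).
Qed.

Lemma center_sum x : x \in lie_center L =
  (pr1 x \in lie_center (sublie_of S)) && (pr2 x \in lie_center (sublie_of T)).
Proof.
apply/centerP/andP=> [cx | [/centerP c1 /centerP c2] y].
  split; apply/centerP=> z; have /lie_eq0[] := cx (val z).
    by rewrite pr1_val.
  by rewrite pr2_valr.
exact/lie_eq0.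
Qed.

Lemma center_val (s : sublie_of S) :
  (val s \in lie_center L) = (s \in lie_center (sublie_of S)).
Proof.
rewrite center_sum pr1_val pr2_val; apply: andb_idr => _.
by apply/centerP => y; exact: lie0l.
Qed.

Lemma center_valr (t : sublie_of T) :
  (val t \in lie_center L) = (t \in lie_center (sublie_of T)).
Proof.
rewrite center_sum pr1_valr pr2_valr; apply: andb_idl => _.
by apply/centerP => y; exact: lie0l.
Qed.

Lemma lie_val x (s : sublie_of S) : lie (pr1 x) s = 0 -> lie x (val s) = 0.
Proof. by move=> xs; apply/lie_eq0; rewrite pr1_val pr2_val lie0r. Qed.

Lemma lie_valr x (t : sublie_of T) : lie (pr2 x) t = 0 -> lie x (val t) = 0.
Proof. by move=> xt; apply/lie_eq0; rewrite pr1_valr pr2_valr lie0r. Qed.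

Lemma commuting_walk3 (x y : L) :
  noncommutative (sublie_of S) -> noncommutative (sublie_of T) ->
  x \notin lie_center L -> y \notin lie_center L ->
  exists u v : L, [/\ u \notin lie_center L, v \notin lie_center L,
    lie x u = 0, lie u v = 0 & lie v y = 0].
Proof.
move=> /noncommutative_noncentral[s ns] /noncommutative_noncentral[t nt].
have lie_pr1 z : lie z (val (pr1 z)) = 0 by apply: lie_val; exact: liexx.
have lie_pr2 z : lie z (val (pr2 z)) = 0 by apply: lie_valr; exact: liexx.
have lieST (a : sublie_of S) (b : sublie_of T) : lie (val a) (val b) = 0.
  by apply: lie_valr; rewrite pr2_val lie0l.
pose cS (a : sublie_of S) := a \in lie_center (sublie_of S).
pose cT (b : sublie_of T) := b \in lie_center (sublie_of T).
have ncE z : (z \notin lie_center L) = ~~ cS (pr1 z) || ~~ cT (pr2 z).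
  by rewrite center_sum negb_and.
rewrite !ncE => nx ny.
have [/andP[x1 y2] | no12] := boolP (~~ cS (pr1 x) && ~~ cT (pr2 y)).
  exists (val (pr1 x)), (val (pr2 y)).
  by rewrite center_val center_valr; split=> //; exact: lie_eq0C.
have [/andP[x2 y1] | no21] := boolP (~~ cT (pr2 x) && ~~ cS (pr1 y)).
  exists (val (pr2 x)), (val (pr1 y)).
  by rewrite center_val center_valr; split=> //; exact: lie_eq0C.
(* The walk now has length 2: its middle vertex is taken twice. *)
have [x1 | x1] := boolP (cS (pr1 x)).
  have x2 : ~~ cT (pr2 x) by rewrite x1 in nx.
  have y1 : cS (pr1 y) by rewrite x2 negbK in no21.
  exists (val s), (val s); rewrite center_val liexx; split=> //.
    by apply: lie_val; exact/centerP.
  by apply/lie_eq0C/lie_val/centerP.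
have y2 : cT (pr2 y) by rewrite x1 negbK in no12.
have y1 : ~~ cS (pr1 y) by rewrite y2 orbF in ny.
have x2 : cT (pr2 x) by rewrite y1 andbT negbK in no21.
exists (val t), (val t); rewrite center_valr liexx; split=> //.
  by apply: lie_valr; exact/centerP.
by apply/lie_eq0C/lie_valr/centerP.
Qed.

Lemma commuting_path3 (x y : commuting_graph L) :
  noncommutative (sublie_of S) -> noncommutative (sublie_of T) ->
  exists2 p, is_path x y p & (size p <= 3)%N.
Proof.
move=> ncS ncT.
have [u [v [nu nv xu uv vy]]] := commuting_walk3 ncS ncT (valP x) (valP y).
apply: (@is_path_of_walk _ x y [:: to_vertex nu; to_vertex nv; y]) => //.
by rewrite /= !weak_adj_commuting ?xu ?uv ?vy ?eqxx.
Qed.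

Section AbelianSummand.
Hypothesis abelT : forall t1 t2 : sublie_of T, lie t1 t2 = 0.

Lemma pr1_noncentral (x : commuting_graph L) :
  pr1 (val x) \notin lie_center (sublie_of S).
Proof.
have := valP x; rewrite center_sum negb_and => /orP[//|].
by case/negP; apply/centerP; exact: abelT.
Qed.

Lemma val_noncentral (u : commuting_graph (sublie_of S)) :
  val (val u) \notin lie_center L.
Proof. by rewrite center_val; exact: (valP u). Qed.

Definition vertex_pr1 (x : commuting_graph L) :
  commuting_graph (sublie_of S) := to_vertex (pr1_noncentral x).
Definition vertex_val (u : commuting_graph (sublie_of S)) :
  commuting_graph L := to_vertex (val_noncentral u).

Lemma vertex_valK : cancel vertex_val vertex_pr1.
Proof. by move=> u; apply: val_inj; exact: pr1_val. Qed.

Lemma weak_adj_pr1 (x y : commuting_graph L) :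
  weak_adj x y = weak_adj (vertex_pr1 x) (vertex_pr1 y).
Proof.
rewrite !weak_adj_commuting; apply/eqP/eqP => [/lie_eq0[] // | xy0].
by apply/lie_eq0; split.
Qed.

End AbelianSummand.

End DirectSum.

Theorem proposition6 (R : realType) (F : fieldType) (L : lieAlgType F)
    (hL : decomposable L) :
  (forall (L1 A : lieSubalg L) (k : nat),
     noncommutative (sublie_of L1) ->
     (0 < k)%N -> lie_isomorphic (sublie_of A) (abelian_lie F k) ->
     is_direct_sum L1 A ->
     (gconnected (commuting_graph L) <->
      gconnected (commuting_graph (sublie_of L1))) /\
     (gconnected (commuting_graph L) ->
      gconnected (commuting_graph (sublie_of L1)) ->
      diam R (commuting_graph L) = diam R (commuting_graph (sublie_of L1)))) /\
  (forall L1 L2 : lieSubalg L,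
     noncommutative (sublie_of L1) -> noncommutative (sublie_of L2) ->
     is_direct_sum L1 L2 ->
     gconnected (commuting_graph L) /\
     (diam R (commuting_graph L) <= (3%:R : R)%:E)%E).
Proof.
split=> [L1 A k nc1 _ /isomorphic_abelian abA sum1A | L1 L2 nc1 nc2 sum12].
  have sK := vertex_valK sum1A abA; have adj1 := weak_adj_pr1 sum1A abA.
  split=> [|_ _]; first exact: gconnected_blowup sK adj1.
  exact: diam_blowup sK adj1 R (noncommutative_two_vertices nc1).
split=> [x y _|].
  by have [p xy_p _] := commuting_path3 sum12 x y nc1 nc2; exists p.
by apply: diam_le_nat => x y _; exact: (commuting_path3 sum12).
Qed.
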